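(* Let $Q(x,y)=ax^2+hxy+by^2$ be an indefinite integer binary quadratic form not representing zero (that is, $Q(x,y)\ne0$ for all $(x,y)\in\mathbb{Z}^2\setminus\{(0,0)\}$). Then $Q$ is a Galois form if and only if the values $a=Q(1,0)$, $b=Q(0,1)$, $c=Q(1,1)=a+b+h$ satisfy $$ab<0,\qquad ac<0,\qquad ac'>0,\quad\text{where } c'=2a+2b-c.$$
   Context: A form $Q(x,y)=ax^2+hxy+by^2$ as in the claim is called a Galois form if the continued fraction expansion of the dominant (maximal modulus) root $\alpha$ of the equation $Q(\alpha,1)=a\alpha^2+h\alpha+b=0$ is pure periodic, i.e. $\alpha=[\overline{b_1,\ldots,b_l}]$ with positive integers $b_1,\ldots,b_l$ (the block repeated forever), where $[c_0,c_1,c_2,\ldots]=c_0+\cfrac{1}{c_1+\cfrac{1}{c_2+\cdots}}$. *)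

(* Defs.v *)
From Stdlib Require Import Reals ZArith List.
From Coquelicot Require Import Coquelicot.

(** The form [coef_xx * x^2 + coef_xy * x * y + coef_yy * y^2]. The middle
    coefficient is an arbitrary integer, not necessarily even. *)
Record bqform : Type := BQForm { coef_xx : Z; coef_xy : Z; coef_yy : Z }.

Definition qval (Q : bqform) (x y : Z) : Z :=
  (coef_xx Q * x ^ 2 + coef_xy Q * x * y + coef_yy Q * y ^ 2)%Z.

Definition qvalR (Q : bqform) (x y : R) : R :=
  (IZR (coef_xx Q) * x ^ 2 + IZR (coef_xy Q) * x * y + IZR (coef_yy Q) * y ^ 2)%R.

Definition indefinite (Q : bqform) : Prop :=
  (exists x y : Z, (0 < qval Q x y)%Z) /\ (exists x y : Z, (qval Q x y < 0)%Z).

Definition represents_zero (Q : bqform) : Prop :=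
  exists x y : Z, (x, y) <> (0, 0)%Z /\ qval Q x y = 0%Z.

Definition is_root (Q : bqform) (t : R) : Prop := qvalR Q t 1 = 0%R.

(** Only real roots are compared: an indefinite form not representing zero has
    no others. If the two roots have equal modulus, both are dominant. *)
Definition is_dominant_root (Q : bqform) (t : R) : Prop :=
  is_root Q t /\ forall s : R, is_root Q s -> (Rabs s <= Rabs t)%R.

(** The finite continued fraction [c_0, ..., c_n], with [n + 1] terms. *)
Fixpoint cf_convergent (c : nat -> Z) (n : nat) : R :=
  match n with
  | O => IZR (c 0%nat)
  | S m => (IZR (c 0%nat) + / cf_convergent (fun k => c (S k)) m)%R
  end.

(** Infinite regular continued fraction expansion. Positivity of the partial
    quotients after [c 0] makes every convergent well defined and makes the
    expansion of [x] unique. *)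
Definition is_cf_expansion (c : nat -> Z) (x : R) : Prop :=
  (forall n : nat, (0 < c (S n))%Z) /\ is_lim_seq (cf_convergent c) (Finite x).

Definition repeat_block (l : list Z) (n : nat) : Z :=
  nth (Nat.modulo n (length l)) l 0%Z.

Definition purely_periodic_cf (x : R) : Prop :=
  exists l : list Z,
    l <> nil /\ List.Forall (fun b => (0 < b)%Z) l /\
    is_cf_expansion (repeat_block l) x.

Definition galois_form (Q : bqform) : Prop :=
  exists alpha : R, is_dominant_root Q alpha /\ purely_periodic_cf alpha.

(* Main.v *)
Require Import Defs.
From Stdlib Require Import Reals ZArith List.
From Coquelicot Require Import Coquelicot.
From Stdlib Require Import Lra Lia Classical.
From Stdlib Require FinFun.

#[local] Arguments Z.mul : simpl never.

(** Write [Q(t) = Q(t,1)]. The three sign conditions say that [Q(0)] and [Q(1)]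
    have the sign opposite to [a] while [Q(-1)] has the sign of [a]; hence they
    say that one root exceeds [1] and the other lies in [(-1,0)]. The statement
    is therefore Galois' theorem on purely periodic continued fractions, and
    both directions can be read off from integers.

    If the dominant root [x] has a purely periodic expansion, running through
    one period shows that [x] is fixed by a Moebius map
    [t |-> (p t + p') / (q t + q')], where the matrix is a product of matrices
    [(b 1; 1 0)] with [b > 0] ([cf_block_moebius]). So [x] is a root of
    [q t^2 + (q' - p) t - p']. As [Q] does not represent zero, [x] is
    irrational, which makes this polynomial proportional to [Q]. Its values at
    [0], [1] and [-1] have the required signs because of inequalities between
    the entries that hold for every such product.

    Conversely, after a change of sign [a > 0]. If [x = m + 1/y] with
    [m] the integer part of the root [x > 1], then [y] is the root of another
    form satisfying the same sign conditions, [cf_step Q], which has the same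
    discriminant. Only finitely many such forms share a discriminant, and
    [cf_step] is injective on them ([cf_step_inj]): a quadratic polynomial that
    is negative at [0] and has positive leading coefficient changes sign only
    once on the positive axis, and this recovers [m] from the image. So the
    orbit of [Q] returns to [Q] itself and the integer parts repeat from the
    start. They are the partial quotients of [x] by
    [complete_quotients_expansion]. *)

(** * Convergents *)

Lemma cf_convergent_ge_1 (n : nat) :
  forall c : nat -> Z, (forall k, (0 < c k)%Z) -> (1 <= cf_convergent c n)%R.
Proof.
  induction n as [|n IH]; intros c Hc; simpl.
  - apply (IZR_le 1); specialize (Hc 0%nat); lia.
  - assert (H0 : (1 <= IZR (c 0%nat))%R)
      by (apply (IZR_le 1); specialize (Hc 0%nat); lia).
    assert (H1 := IH (fun k => c (S k)) (fun k => Hc (S k))).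
    assert (0 < / cf_convergent (fun k => c (S k)) n)%R
      by (apply Rinv_0_lt_compat; lra).
    lra.
Qed.

Lemma cf_convergent_ext (n : nat) :
  forall c d : nat -> Z, (forall k, c k = d k) ->
  cf_convergent c n = cf_convergent d n.
Proof.
  induction n as [|n IH]; intros c d H; simpl.
  - now rewrite H.
  - rewrite H. do 2 f_equal. apply IH. intros k; apply H.
Qed.

(** Inversion shrinks a distance [e] between two numbers [>= 1] to at most
    [e / (1 + e)], because their product is at least [1 + e]. This map sends
    [1 / (n + 1)] to [1 / (n + 2)], which gives the bound below. *)
Lemma inv_contraction (x y e : R) :
  (1 <= x)%R -> (1 <= y)%R -> (0 < e)%R -> (Rabs (x - y) <= / e)%R ->
  (Rabs (/ x - / y) <= / (e + 1))%R.
Proof.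
  intros Hx Hy He H.
  replace (/ x - / y)%R with ((y - x) * / (x * y))%R by (field; lra).
  rewrite Rabs_mult, (Rabs_minus_sym y x), (Rabs_pos_eq (/ (x * y))).
  2: { apply Rlt_le, Rinv_0_lt_compat; nra. }
  assert (Hxy : (1 + Rabs (x - y) <= x * y)%R).
  { unfold Rabs; destruct (Rcase_abs (x - y)); nra. }
  assert (Hd := Rabs_pos (x - y)).
  set (d := Rabs (x - y)) in *.
  assert (Hde : (d * e <= 1)%R).
  { apply Rmult_le_reg_r with (/ e)%R; [now apply Rinv_0_lt_compat|].
    rewrite Rmult_assoc, Rinv_r by lra. lra. }
  apply Rmult_le_reg_r with ((x * y) * (e + 1))%R; [nra|].
  replace (d * / (x * y) * (x * y * (e + 1)))%R with (d * (e + 1))%R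
    by (field; nra).
  replace (/ (e + 1) * (x * y * (e + 1)))%R with (x * y)%R by (field; lra).
  lra.
Qed.

Lemma cf_convergent_error (n : nat) :
  forall (c : nat -> Z) (x : nat -> R),
  (forall k, (0 < c k)%Z) -> (forall k, (1 <= x k)%R) ->
  (forall k, x k = IZR (c k) + / x (S k))%R ->
  (Rabs (cf_convergent c n - x 0%nat) <= / (INR n + 1))%R.
Proof.
  induction n as [|n IH]; intros c x Hc Hx Hrec.
  - simpl. rewrite (Hrec 0%nat), Rplus_0_l, Rinv_1, Rabs_minus_sym.
    replace (IZR (c 0%nat) + / x 1%nat - IZR (c 0%nat))%R with (/ x 1%nat)%R
      by ring.
    assert (H1 := Hx 1%nat).
    rewrite Rabs_pos_eq by (apply Rlt_le, Rinv_0_lt_compat; lra).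
    rewrite <- Rinv_1. apply Rinv_le_contravar; lra.
  - rewrite S_INR. simpl cf_convergent. rewrite (Hrec 0%nat).
    replace (IZR (c 0%nat) + / cf_convergent (fun k => c (S k)) n -
             (IZR (c 0%nat) + / x 1%nat))%R
      with (/ cf_convergent (fun k => c (S k)) n - / x 1%nat)%R by ring.
    apply inv_contraction.
    + apply cf_convergent_ge_1. intros k; apply Hc.
    + apply Hx.
    + assert (H := pos_INR n); lra.
    + apply (IH (fun k => c (S k)) (fun k => x (S k))).
      * intros k; apply Hc.
      * intros k; apply Hx.
      * intros k; apply Hrec.
Qed.

Lemma complete_quotients_expansion (c : nat -> Z) (x : nat -> R) :
  (forall k, (0 < c k)%Z) -> (forall k, (1 <= x k)%R) ->
  (forall k, x k = IZR (c k) + / x (S k))%R ->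
  is_cf_expansion c (x 0%nat).
Proof.
  intros Hc Hx Hrec. split; [intros n; apply Hc|].
  apply is_lim_seq_spec. intros eps.
  destruct (archimed_cor1 eps (cond_pos eps)) as [N [HN HN0]].
  exists N. intros n Hn.
  apply Rle_lt_trans with (/ (INR n + 1))%R.
  - now apply cf_convergent_error.
  - apply Rlt_trans with (/ INR N)%R; [|exact HN].
    apply le_INR in Hn. apply lt_INR in HN0. simpl in HN0.
    apply Rinv_lt_contravar; nra.
Qed.

(** * From a period to the signs *)

(** In the matrix [(p p'; q q')] the first row has the larger sum, and so does
    the first column. These two inequalities are the signs at [1] and [-1] of
    the fixed-point polynomial [q t^2 + (q' - p) t - p']. The entrywise
    inequalities make them survive multiplication on the left by [(b 1; 1 0)]
    with [b > 0]. Since [q > 0] fails for the identity matrix, the block has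
    to be nonempty. *)
Lemma cf_block_moebius (l : list Z) :
  l <> nil -> List.Forall (fun b => (0 < b)%Z) l ->
  exists p p' q q' : Z,
    (0 < p' /\ 0 < q /\ 0 <= q' /\ p' <= p /\ q' <= q /\
     q + q' < p + p' /\ p' + q' < p + q)%Z /\
    forall (c : nat -> Z) (n : nat),
      (forall k, (0 < c k)%Z) ->
      (forall k, (k < length l)%nat -> c k = nth k l 0%Z) ->
      let t := cf_convergent (fun k => c (length l + k)%nat) n in
      (cf_convergent c (length l + n) * (IZR q * t + IZR q') =
       IZR p * t + IZR p')%R.
Proof.
  induction l as [|b l IH]; [easy|]. intros _ Hl.
  inversion Hl as [|? ? Hb Hl']; subst.
  destruct l as [|b' l].
  - exists b, 1%Z, 1%Z, 0%Z. split; [lia|].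
    intros c n Hc Hcl t. simpl length in *.
    assert (Ht : (1 <= t)%R) by (apply cf_convergent_ge_1; intros k; apply Hc).
    change (cf_convergent c (1 + n)) with (IZR (c 0%nat) + / t)%R.
    rewrite Hcl by lia. simpl nth. field. lra.
  - destruct (IH ltac:(easy) Hl') as (p & p' & q & q' & Hpq & IHc).
    exists (b * p + q)%Z, (b * p' + q')%Z, p, p'. split; [nia|].
    intros c n Hc Hcl t.
    set (m := length (b' :: l)) in *.
    assert (E : (cf_convergent (fun k => c (S k)) (m + n) * (IZR q * t + IZR q')
                 = IZR p * t + IZR p')%R).
    { apply (IHc (fun k => c (S k)) n (fun k => Hc (S k))).
      intros k Hk. apply (Hcl (S k)). now apply -> Nat.succ_lt_mono. }
    clearbody t.
    change (cf_convergent c (length (b :: b' :: l) + n))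
      with (IZR (c 0%nat) + / cf_convergent (fun k => c (S k)) (m + n))%R.
    assert (Hu : (1 <= cf_convergent (fun k => c (S k)) (m + n))%R)
      by (apply cf_convergent_ge_1; intros k; apply Hc).
    set (u := cf_convergent (fun k => c (S k)) (m + n)) in *.
    rewrite (Hcl 0%nat) by (simpl; lia). simpl nth.
    rewrite <- E, !plus_IZR, !mult_IZR.
    rewrite Rmult_plus_distr_r.
    replace (/ u * (u * (IZR q * t + IZR q')))%R with (IZR q * t + IZR q')%R
      by (field; lra).
    transitivity (IZR b * (IZR p * t + IZR p') + (IZR q * t + IZR q'))%R.
    + rewrite <- E. field; lra.
    + ring.
Qed.

Lemma repeat_block_pos (l : list Z) (n : nat) :
  l <> nil -> List.Forall (fun b => (0 < b)%Z) l -> (0 < repeat_block l n)%Z.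
Proof.
  intros Hne Hl. unfold repeat_block.
  apply (proj1 (Forall_nth _ l) Hl).
  apply Nat.mod_upper_bound. destruct l; easy.
Qed.

Lemma purely_periodic_fixed_point (x : R) :
  purely_periodic_cf x ->
  exists p p' q q' : Z,
    (0 < p' /\ 0 < q /\ q + q' < p + p' /\ p' + q' < p + q)%Z /\
    (x * (IZR q * x + IZR q') = IZR p * x + IZR p')%R.
Proof.
  intros (l & Hne & Hl & _ & Hlim).
  destruct (cf_block_moebius l Hne Hl) as (p & p' & q & q' & Hpq & H).
  exists p, p', q, q'. split; [lia|].
  set (L := length l) in *.
  assert (HL : L <> 0%nat) by (unfold L; destruct l; easy).
  set (u := cf_convergent (repeat_block l)) in *.
  assert (E : forall n, (u (n + L)%nat * (IZR q * u n + IZR q') =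
                         IZR p * u n + IZR p')%R).
  { intros n. rewrite Nat.add_comm.
    replace (u n) with (cf_convergent (fun k => repeat_block l (L + k)) n).
    - apply H.
      + intros k. now apply repeat_block_pos.
      + intros k Hk. unfold repeat_block. now rewrite Nat.mod_small.
    - apply cf_convergent_ext. intros k. unfold repeat_block. fold L.
      f_equal. rewrite Nat.add_comm. rewrite <- (Nat.mul_1_l L) at 1.
      now apply Nat.Div0.mod_add. }
  assert (Hlin : forall y z : Z,
    is_lim_seq (fun n => IZR y * u n + IZR z)%R (IZR y * x + IZR z)%R).
  { intros y z. apply is_lim_seq_plus'; [|apply is_lim_seq_const].
    apply (is_lim_seq_scal_l u (IZR y) (Finite x) Hlim). }
  assert (H1 := is_lim_seq_mult' _ _ _ _
                  (proj1 (is_lim_seq_incr_n u L (Finite x)) Hlim) (Hlin q q')).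
  assert (H2 := is_lim_seq_ext _ _ _ E H1).
  assert (H3 := is_lim_seq_unique _ _ H2).
  rewrite (is_lim_seq_unique _ _ (Hlin p p')) in H3.
  now inversion H3.
Qed.

Lemma root_irrational (Q : bqform) (x : R) (u v : Z) :
  ~ represents_zero Q -> is_root Q x ->
  (IZR u * x + IZR v = 0)%R -> u = 0%Z /\ v = 0%Z.
Proof.
  intros HQ Hx E. apply NNPP. intros Huv. apply HQ.
  exists v, (- u)%Z. split.
  - intros H. inversion H. apply Huv. lia.
  - apply eq_IZR. unfold qval. unfold is_root, qvalR in Hx.
    rewrite !Z.pow_2_r, !plus_IZR, !mult_IZR, opp_IZR.
    replace (IZR v) with (- (IZR u * x))%R by lra.
    transitivity (IZR u ^ 2 * (IZR (coef_xx Q) * x ^ 2 + IZR (coef_xy Q) * x * 1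
                               + IZR (coef_yy Q) * 1 ^ 2))%R; [ring|].
    rewrite Hx. ring.
Qed.

Lemma purely_periodic_root_signs (Q : bqform) (x : R) :
  ~ represents_zero Q -> is_root Q x -> purely_periodic_cf x ->
  let (a, h, b) := Q in
  (a * b < 0 /\ a * (a + h + b) < 0 /\ a * (a - h + b) > 0)%Z.
Proof.
  intros HQ Hx Hper.
  destruct (purely_periodic_fixed_point x Hper) as (p & p' & q & q' & Hpq & E).
  assert (Ha : coef_xx Q <> 0%Z).
  { intros Ha. apply HQ. exists 1%Z, 0%Z. split; [easy|].
    unfold qval. rewrite Ha. ring. }
  (* The combination of the two polynomials that cancels the leading terms. *)
  assert (Hprop := root_irrational Q x
     (q * coef_xy Q - coef_xx Q * (q' - p)) (q * coef_yy Q + coef_xx Q * p') HQ Hx).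
  destruct Q as [a h b]. unfold is_root, qvalR in Hx. simpl in *.
  destruct Hprop as [Hh Hb].
  { repeat rewrite ?plus_IZR, ?minus_IZR, ?mult_IZR.
    transitivity (IZR q * (IZR a * (x * (x * 1)) + IZR h * x * 1
                           + IZR b * (1 * (1 * 1)))
                  - IZR a * (x * (IZR q * x + IZR q')
                             - (IZR p * x + IZR p')))%R; [ring|].
    rewrite Hx, E. ring. }
  assert (Ha2 : (0 < a * a)%Z) by nia.
  assert (E0 : (q * (a * b) = - (a * a * p'))%Z) by nia.
  assert (E1 : (q * (a * (a + h + b)) = - (a * a * (p + p' - (q + q'))))%Z) by nia.
  assert (E2 : (q * (a * (a - h + b)) = a * a * (p + q - (p' + q')))%Z) by nia.
  repeat split.
  - assert (0 < a * a * p')%Z by nia. nia.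
  - assert (0 < a * a * (p + p' - (q + q')))%Z by (apply Z.mul_pos_pos; lia). nia.
  - assert (0 < a * a * (p + q - (p' + q')))%Z by (apply Z.mul_pos_pos; lia). nia.
Qed.

(** * Reduced forms and the continued fraction step *)

(** One root exceeds [1] and the other lies in [(-1,0)]. *)
Definition reduced (Q : bqform) : Prop :=
  let (a, h, b) := Q in (0 < a /\ b < 0 /\ a + h + b < 0 /\ 0 < a - h + b)%Z.

Definition disc (Q : bqform) : Z :=
  let (a, h, b) := Q in (h * h - 4 * a * b)%Z.

(** The larger root when the leading coefficient is positive. *)
Definition top_root (Q : bqform) : R :=
  ((sqrt (IZR (disc Q)) - IZR (coef_xy Q)) / (2 * IZR (coef_xx Q)))%R.

Definition top_quotient (Q : bqform) : Z := Int_part (top_root Q).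

(** The form [-Q(m x + y, x)]: the substitution [t = m + 1/s] in [Q(t,1)], with
    the sign that makes the leading coefficient positive again. *)
Definition cf_step (Q : bqform) : bqform :=
  let (a, h, b) := Q in
  let m := top_quotient Q in
  BQForm (- (a * m * m + h * m + b)) (- (2 * a * m + h)) (- a).

Lemma disc_pos (Q : bqform) : reduced Q -> (0 < disc Q)%Z.
Proof.
  destruct Q as [a h b]; simpl; intros H.
  assert (a * b < 0)%Z by nia. assert (H2 := Z.square_nonneg h). lia.
Qed.

Lemma top_root_gt_1 (Q : bqform) : reduced Q -> (1 < top_root Q)%R.
Proof.
  intros HQ. assert (HD := disc_pos Q HQ). unfold top_root.
  destruct Q as [a h b]; simpl in *.
  assert (Ha : (0 < IZR a)%R) by (apply IZR_lt; lia).
  assert (Hr := sqrt_pos (IZR (h * h - 4 * a * b))).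
  assert (Hrr : (sqrt (IZR (h * h - 4 * a * b)) * sqrt (IZR (h * h - 4 * a * b))
                 = IZR (h * h - 4 * a * b))%R)
    by (apply sqrt_sqrt, IZR_le; lia).
  assert (H1 : (IZR ((2 * a + h) * (2 * a + h)) < IZR (h * h - 4 * a * b))%R)
    by (apply IZR_lt; nia).
  set (r := sqrt (IZR (h * h - 4 * a * b))) in *.
  rewrite <- Hrr, mult_IZR, plus_IZR, mult_IZR in H1.
  apply Rmult_lt_reg_r with (2 * IZR a)%R; [lra|].
  replace ((r - IZR h) / (2 * IZR a) * (2 * IZR a))%R with (r - IZR h)%R
    by (field; lra).
  nra.
Qed.

(** The integer part is characterised by a sign change of [Q(t,1)]; the values
    at [m] and [m + 1] cannot vanish because [Q] does not represent zero. *)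
Lemma top_quotient_spec (Q : bqform) :
  reduced Q -> ~ represents_zero Q ->
  let m := top_quotient Q in
  let (a, h, b) := Q in
  (1 <= m /\ a * m * m + h * m + b < 0 /\
   0 < a * (m + 1) * (m + 1) + h * (m + 1) + b)%Z.
Proof.
  intros HQ H0 m.
  assert (HD := disc_pos Q HQ). assert (Hx := top_root_gt_1 Q HQ).
  destruct (base_Int_part (top_root Q)) as [Hm1 Hm2].
  fold (top_quotient Q) in Hm1, Hm2. fold m in Hm1, Hm2.
  assert (Hm : (1 <= m)%Z).
  { assert (0 < m)%Z; [|lia]. apply lt_IZR. lra. }
  assert (Hnz : forall n : Z, qval Q n 1 <> 0%Z).
  { intros n Hn. apply H0. exists n, 1%Z. split; [easy|exact Hn]. }
  assert (Hn0 := Hnz m). assert (Hn1 := Hnz (m + 1)%Z).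
  unfold top_root in *. clearbody m. clear H0 Hnz.
  destruct Q as [a h b]; unfold qval in *; simpl in HQ, HD, Hx, Hm1, Hm2, Hn0, Hn1.
  assert (Ha : (0 < IZR a)%R) by (apply IZR_lt; lia).
  assert (Hr := sqrt_pos (IZR (h * h - 4 * a * b))).
  assert (Hrr : (sqrt (IZR (h * h - 4 * a * b)) * sqrt (IZR (h * h - 4 * a * b))
                 = IZR (h * h - 4 * a * b))%R)
    by (apply sqrt_sqrt, IZR_le; lia).
  set (r := sqrt (IZR (h * h - 4 * a * b))) in *.
  set (x := ((r - IZR h) / (2 * IZR a))%R) in *.
  assert (Ex : (r = 2 * IZR a * x + IZR h)%R) by (unfold x; field; lra).
  assert (Hneg : (4 * a * (a * m * m + h * m + b) <= 0)%Z).
  { replace (4 * a * (a * m * m + h * m + b))%Z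
      with ((2 * a * m + h) * (2 * a * m + h) - (h * h - 4 * a * b))%Z by ring.
    apply le_IZR. rewrite minus_IZR, <- Hrr, mult_IZR, plus_IZR, !mult_IZR.
    assert (IZR 1 <= IZR m)%R by now apply IZR_le.
    (* The lower bound on [2 a m + h] comes from [Q(1,1) < 0]. *)
    assert (H1 : (IZR ((2 * a + h) * (2 * a + h)) < IZR (h * h - 4 * a * b))%R)
      by (apply IZR_lt; nia).
    rewrite <- Hrr, mult_IZR, plus_IZR, mult_IZR in H1.
    assert (- r < 2 * IZR a + IZR h)%R by nra.
    assert (- r <= 2 * IZR a * IZR m + IZR h)%R by nra.
    assert (2 * IZR a * IZR m + IZR h <= r)%R by nra.
    nra. }
  assert (Hpos : (0 <= 4 * a * (a * (m + 1) * (m + 1) + h * (m + 1) + b))%Z).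
  { replace (4 * a * (a * (m + 1) * (m + 1) + h * (m + 1) + b))%Z
      with ((2 * a * (m + 1) + h) * (2 * a * (m + 1) + h)
            - (h * h - 4 * a * b))%Z by ring.
    apply le_IZR. rewrite minus_IZR, <- Hrr, mult_IZR, plus_IZR, !mult_IZR, plus_IZR.
    assert (r <= 2 * IZR a * (IZR m + 1) + IZR h)%R by nra.
    nra. }
  repeat split; [exact Hm| |]; nia.
Qed.

(** Strict convexity of [a t^2 + h t + b]. *)
Lemma quadratic_neg_between (a h b m n : Z) :
  (0 < a -> 0 <= m <= n -> 0 < n -> b < 0 -> a * n * n + h * n + b < 0 ->
   a * m * m + h * m + b < 0)%Z.
Proof.
  intros Ha Hm Hn H0 H1.
  assert (E : (n * (a * m * m + h * m + b) =
          (n - m) * b + m * (a * n * n + h * n + b) - a * n * (m * (n - m)))%Z)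
    by ring.
  assert ((n - m) * b <= 0)%Z by nia.
  assert (m * (a * n * n + h * n + b) <= 0)%Z by nia.
  assert ((n - m) * b + m * (a * n * n + h * n + b) < 0)%Z.
  { destruct (Z.eq_dec m 0); nia. }
  assert (0 <= m * (n - m))%Z by nia.
  assert (0 <= a * n)%Z by nia.
  assert (0 <= a * n * (m * (n - m)))%Z by (apply Z.mul_nonneg_nonneg; assumption).
  nia.
Qed.

Lemma sign_change_unique (a h b m n : Z) :
  (0 < a -> b < 0 -> 0 <= m -> 0 <= n ->
   a * m * m + h * m + b < 0 -> 0 < a * (m + 1) * (m + 1) + h * (m + 1) + b ->
   a * n * n + h * n + b < 0 -> 0 < a * (n + 1) * (n + 1) + h * (n + 1) + b ->
   m = n)%Z.
Proof.
  intros Ha Hb Hm Hn H1 H2 H3 H4.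
  destruct (Z.lt_trichotomy m n) as [H|[H|H]]; [|exact H|].
  - assert (X := quadratic_neg_between a h b (m + 1) n Ha ltac:(lia) ltac:(lia) Hb H3).
    lia.
  - assert (X := quadratic_neg_between a h b (n + 1) m Ha ltac:(lia) ltac:(lia) Hb H1).
    lia.
Qed.

Lemma cf_step_disc (Q : bqform) : disc (cf_step Q) = disc Q.
Proof. destruct Q as [a h b]; simpl. ring. Qed.

Lemma cf_step_reduced (Q : bqform) :
  reduced Q -> ~ represents_zero Q -> reduced (cf_step Q).
Proof.
  intros HQ H0. assert (Hm := top_quotient_spec Q HQ H0).
  destruct Q as [a h b]. simpl in Hm, HQ |- *.
  set (m := top_quotient (BQForm a h b)) in *. clearbody m.
  destruct Hm as (Hm & H1 & H2).
  assert (X := quadratic_neg_between a h b (m - 1) m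
                 ltac:(lia) ltac:(lia) ltac:(lia) ltac:(lia) H1).
  repeat split; try lia; nia.
Qed.

Lemma cf_step_nonzero (Q : bqform) :
  ~ represents_zero Q -> ~ represents_zero (cf_step Q).
Proof.
  intros H0 (x & y & Hxy & E). apply H0.
  exists (top_quotient Q * x + y)%Z, x. split.
  - intros H. injection H as H1 H2. apply Hxy.
    rewrite H2, Z.mul_0_r in H1. now rewrite H2, <- H1.
  - destruct Q as [a h b]. unfold qval in *. simpl coef_xx in *.
    simpl coef_xy in *. simpl coef_yy in *.
    set (m := top_quotient (BQForm a h b)) in *. clearbody m.
    apply Z.opp_inj. rewrite Z.opp_0, <- E. ring.
Qed.

(** The form [Q] can be reconstructed from its image and [m]. The integer [m]
    is itself determined by the image: the coefficients of the polynomial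
    [Q(m - t, 1)] in [t] can be read off the image, and [Q(0,1) < 0 < Q(-1,1)]
    says that this polynomial changes sign between [m] and [m + 1]. *)
Lemma cf_step_inj (Q1 Q2 : bqform) :
  reduced Q1 -> ~ represents_zero Q1 -> reduced Q2 -> ~ represents_zero Q2 ->
  cf_step Q1 = cf_step Q2 -> Q1 = Q2.
Proof.
  intros R1 N1 R2 N2 E.
  assert (S1 := top_quotient_spec Q1 R1 N1).
  assert (S2 := top_quotient_spec Q2 R2 N2).
  destruct Q1 as [a h b], Q2 as [a' h' b']. simpl in R1, R2, S1, S2, E.
  set (m := top_quotient (BQForm a h b)) in *. clearbody m.
  set (n := top_quotient (BQForm a' h' b')) in *. clearbody n.
  injection E as E1 E2 E3.
  assert (a' = a) by lia. subst a'.
  assert (Hh : h' = (2 * a * m + h - 2 * a * n)%Z) by lia. subst h'.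
  assert (Hb : b' = (a * m * m + h * m + b - a * n * n
                     - (2 * a * m + h - 2 * a * n) * n)%Z) by lia. subst b'.
  assert (m = n).
  { apply (sign_change_unique a (- (2 * a * m + h)) (a * m * m + h * m + b));
      try lia; nia. }
  subst n. f_equal; ring.
Qed.

Lemma top_root_step (Q : bqform) :
  reduced Q -> ~ represents_zero Q ->
  (top_root Q = IZR (top_quotient Q) + / top_root (cf_step Q))%R.
Proof.
  intros HQ H0. assert (Hm := top_quotient_spec Q HQ H0).
  assert (HD := disc_pos Q HQ).
  unfold top_root at 1 2. rewrite cf_step_disc.
  destruct Q as [a h b]. simpl in *.
  set (m := top_quotient (BQForm a h b)) in *. clearbody m.
  destruct Hm as (Hm & H1 & _).
  assert (Ha : (0 < IZR a)%R) by (apply IZR_lt; lia).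
  assert (Hr := sqrt_pos (IZR (h * h - 4 * a * b))).
  assert (Hrr : (sqrt (IZR (h * h - 4 * a * b)) * sqrt (IZR (h * h - 4 * a * b))
                 = IZR (h * h - 4 * a * b))%R)
    by (apply sqrt_sqrt, IZR_le; lia).
  set (r := sqrt (IZR (h * h - 4 * a * b))) in *.
  set (A := (a * m * m + h * m + b)%Z) in *.
  (* With [u = 2 a m + h], clearing denominators leaves
     [(r - u)(r + u) = - 4 a Q(m,1)]. *)
  assert (HA : (IZR A < 0)%R) by now apply IZR_lt.
  assert (E : ((r - (2 * IZR a * IZR m + IZR h)) * (r + (2 * IZR a * IZR m + IZR h))
               = - (4 * IZR a * IZR A))%R).
  { transitivity (r * r - (2 * IZR a * IZR m + IZR h) ^ 2)%R; [ring|].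
    rewrite Hrr. unfold A.
    repeat rewrite ?minus_IZR, ?plus_IZR, ?mult_IZR. ring. }
  rewrite !opp_IZR, plus_IZR, !mult_IZR.
  set (u := (2 * IZR a * IZR m + IZR h)%R) in *.
  assert (Hu : (r + u <> 0)%R) by (intros H; rewrite H in E; nra).
  replace (r - - u)%R with (r + u)%R by ring.
  apply Rmult_eq_reg_r with (2 * IZR a * (r + u))%R; [|nra].
  transitivity ((r - IZR h) * (r + u))%R; [field; lra|].
  transitivity ((2 * IZR a * IZR m) * (r + u) - 4 * IZR a * IZR A)%R.
  - unfold u in *. lra.
  - field. split; lra.
Qed.

(** * Periodicity *)

(** Injectivity makes the orbit purely periodic: if it never came back to its
    starting point, then all its terms would be distinct. *)
Lemma injective_orbit_returns {A : Type} (f : A -> A) (P : A -> Prop)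
    (support : list A) (x : A) :
  (forall y, P y -> P (f y)) ->
  (forall y z, P y -> P z -> f y = f z -> y = z) ->
  (forall y, P y -> In y support) ->
  P x -> exists n, (0 < n)%nat /\ Nat.iter n f x = x.
Proof.
  intros Hf Hinj Hfin Hx. apply NNPP. intros Hno.
  assert (HP : forall n, P (Nat.iter n f x)).
  { induction n; simpl; auto. }
  assert (Hne : forall i d, Nat.iter i f x <> Nat.iter (i + S d) f x).
  { induction i as [|i IH]; intros d E.
    - apply Hno. exists (S d). split; [lia|]. now symmetry.
    - apply (IH d). apply Hinj; try apply HP. exact E. }
  assert (Hdist : FinFun.Injective (fun n => Nat.iter n f x)).
  { intros i j E. destruct (Nat.lt_trichotomy i j) as [H|[H|H]]; [|exact H|].
    - exfalso. apply (Hne i (j - i - 1)%nat).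
      now replace (i + S (j - i - 1))%nat with j by lia.
    - exfalso. apply (Hne j (i - j - 1)%nat).
      now replace (j + S (i - j - 1))%nat with i by lia. }
  assert (Hlen : (length (map (fun n => Nat.iter n f x)
                     (seq 0 (S (length support)))) <= length support)%nat).
  { apply NoDup_incl_length.
    - apply FinFun.Injective_map_NoDup; [exact Hdist|apply seq_NoDup].
    - intros y Hy. apply in_map_iff in Hy. destruct Hy as (n & <- & _).
      apply Hfin, HP. }
  rewrite length_map, length_seq in Hlen. lia.
Qed.

Lemma reduced_finite (D : Z) :
  exists support : list bqform,
    forall Q, reduced Q -> disc Q = D -> In Q support.
Proof.
  set (range := map (fun n => (Z.of_nat n - D)%Z) (seq 0 (Z.to_nat (2 * D + 1)))).
  assert (Hrange : forall z, (- D <= z <= D)%Z -> In z range).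
  { intros z Hz. apply in_map_iff. exists (Z.to_nat (z + D)).
    split; [lia|]. apply in_seq. lia. }
  exists (map (fun t => BQForm (fst t) (fst (snd t)) (snd (snd t)))
            (list_prod range (list_prod range range))).
  intros [a h b] HQ HD. simpl in HQ, HD.
  apply in_map_iff. exists (a, (h, b)). split; [reflexivity|].
  assert (a <= a * - b)%Z by nia. assert (- b <= a * - b)%Z by nia.
  assert (Hh := Z.square_nonneg h).
  assert (a <= D)%Z by lia. assert (- b <= D)%Z by lia.
  assert (h * h <= D)%Z by lia.
  repeat apply in_prod; apply Hrange; nia.
Qed.

Lemma reduced_purely_periodic (Q : bqform) :
  reduced Q -> ~ represents_zero Q -> purely_periodic_cf (top_root Q).
Proof.
  intros HQ H0.
  destruct (reduced_finite (disc Q)) as [support Hsupp].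
  destruct (injective_orbit_returns cf_step
    (fun F => reduced F /\ ~ represents_zero F /\ disc F = disc Q) support Q)
    as (L & HL & Hret).
  - intros F (HF & NF & DF). split; [|split].
    + now apply cf_step_reduced.
    + now apply cf_step_nonzero.
    + now rewrite cf_step_disc.
  - intros F G (HF & NF & _) (HG & NG & _). now apply cf_step_inj.
  - intros F (HF & _ & DF). now apply Hsupp.
  - easy.
  - set (s := fun n => Nat.iter n cf_step Q).
    assert (Hs : forall n, reduced (s n) /\ ~ represents_zero (s n)).
    { induction n as [|n [IH1 IH2]]; [easy|]. split.
      - now apply cf_step_reduced.
      - now apply cf_step_nonzero. }
    assert (Hper1 : forall n, s (n + L)%nat = s n).
    { intros n. unfold s. rewrite Nat.iter_add. now rewrite Hret. }
    assert (Hper : forall k n, s (n + k * L)%nat = s n).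
    { induction k as [|k IH]; intros n; simpl.
      - now rewrite Nat.add_0_r.
      - replace (n + (L + k * L))%nat with (n + k * L + L)%nat by lia.
        now rewrite Hper1. }
    set (c := fun n => top_quotient (s n)).
    assert (Hc : forall n, (0 < c n)%Z).
    { intros n. unfold c. destruct (Hs n) as [H1 H2].
      assert (H := top_quotient_spec _ H1 H2).
      cbv zeta in H. destruct (s n). lia. }
    assert (Hexp : is_cf_expansion c (top_root Q)).
    { apply (complete_quotients_expansion c (fun n => top_root (s n))).
      - exact Hc.
      - intros k. apply Rlt_le, top_root_gt_1, Hs.
      - intros k. apply (top_root_step (s k)); apply Hs. }
    assert (Hrep : forall n, repeat_block (map c (seq 0 L)) n = c n).
    { intros n. unfold repeat_block. rewrite length_map, length_seq.
      assert (Hn : (n mod L < L)%nat) by (apply Nat.mod_upper_bound; lia).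
      rewrite (nth_indep _ 0%Z (c 0%nat)) by (now rewrite length_map, length_seq).
      rewrite map_nth, seq_nth by exact Hn. simpl.
      rewrite (Nat.div_mod_eq n L) at 2. unfold c. f_equal.
      rewrite Nat.add_comm, Nat.mul_comm. symmetry. apply Hper. }
    exists (map c (seq 0 L)). split; [|split].
    + destruct L; [lia|]. easy.
    + apply Forall_map, Forall_forall. intros n _. apply Hc.
    + destruct Hexp as [_ Hlim]. split.
      * intros n. rewrite Hrep. apply Hc.
      * apply is_lim_seq_ext with (2 := Hlim).
        intros n. apply cf_convergent_ext. intros k. now rewrite Hrep.
Qed.

Lemma top_root_dominant (Q : bqform) :
  reduced Q -> is_dominant_root Q (top_root Q).
Proof.
  intros HQ. assert (HD := disc_pos Q HQ). assert (Hx := top_root_gt_1 Q HQ).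
  unfold is_dominant_root, is_root, qvalR, top_root in *.
  destruct Q as [a h b]; simpl in *.
  assert (Ha : (0 < IZR a)%R) by (apply IZR_lt; lia).
  (* The sum of the roots is positive. *)
  assert (Hh : (IZR h < 0)%R) by (apply IZR_lt; lia).
  assert (Hr := sqrt_pos (IZR (h * h - 4 * a * b))).
  assert (Hrr : (sqrt (IZR (h * h - 4 * a * b)) * sqrt (IZR (h * h - 4 * a * b))
                 = IZR h * IZR h - 4 * IZR a * IZR b)%R).
  { rewrite sqrt_sqrt by (apply IZR_le; lia).
    now rewrite minus_IZR, !mult_IZR. }
  set (r := sqrt (IZR (h * h - 4 * a * b))) in *.
  set (x := ((r - IZR h) / (2 * IZR a))%R) in *.
  assert (Ex : (r = 2 * IZR a * x + IZR h)%R) by (unfold x; field; lra).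
  clearbody x. split.
  - rewrite Ex in Hrr. nra.
  - intros y Hy.
    assert (E : ((2 * IZR a * y + IZR h - r) * (2 * IZR a * y + IZR h + r) = 0)%R).
    { transitivity (4 * IZR a * (IZR a * (y * (y * 1)) + IZR h * y * 1
        + IZR b * (1 * (1 * 1))) + (IZR h * IZR h - 4 * IZR a * IZR b) - r * r)%R;
        [ring|]. rewrite Hy, Hrr. ring. }
    rewrite (Rabs_pos_eq x) by lra.
    destruct (Rmult_integral _ _ E); apply Rabs_le; split; nra.
Qed.

Lemma reduced_galois (Q : bqform) :
  reduced Q -> ~ represents_zero Q -> galois_form Q.
Proof.
  intros HQ H0. exists (top_root Q). split.
  - now apply top_root_dominant.
  - now apply reduced_purely_periodic.
Qed.

Definition neg_form (Q : bqform) : bqform :=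
  BQForm (- coef_xx Q) (- coef_xy Q) (- coef_yy Q).

Lemma galois_neg_form (Q : bqform) : galois_form (neg_form Q) -> galois_form Q.
Proof.
  assert (Hroot : forall t, is_root (neg_form Q) t <-> is_root Q t).
  { intros t. unfold is_root, qvalR, neg_form. simpl. rewrite !opp_IZR.
    split; intros H; lra. }
  intros (x & [Hx Hdom] & Hper). exists x. split; [split|exact Hper].
  - now apply Hroot.
  - intros s Hs. now apply Hdom, Hroot.
Qed.

Lemma neg_form_nonzero (Q : bqform) :
  ~ represents_zero Q -> ~ represents_zero (neg_form Q).
Proof.
  intros H0 (x & y & Hxy & E). apply H0. exists x, y. split; [exact Hxy|].
  unfold qval, neg_form in *. simpl coef_xx in E. simpl coef_xy in E.
  simpl coef_yy in E. lia.
Qed.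

Theorem proposition4 (Q : bqform)
    (Q_indefinite : indefinite Q)
    (Q_nonzero : ~ represents_zero Q) :
  galois_form Q <->
  (let a := qval Q 1 0 in
   let b := qval Q 0 1 in
   let c := qval Q 1 1 in
   let c' := (2 * a + 2 * b - c)%Z in
   (a * b < 0)%Z /\ (a * c < 0)%Z /\ (a * c' > 0)%Z).
Proof.
  assert (Ea : qval Q 1 0 = coef_xx Q) by (unfold qval; ring).
  assert (Eb : qval Q 0 1 = coef_yy Q) by (unfold qval; ring).
  assert (Ec : qval Q 1 1 = (coef_xx Q + coef_xy Q + coef_yy Q)%Z)
    by (unfold qval; ring).
  rewrite Ea, Eb, Ec. clear Ea Eb Ec. cbv zeta.
  split.
  - intros (x & [Hx _] & Hper).
    assert (H := purely_periodic_root_signs Q x Q_nonzero Hx Hper).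
    destruct Q as [a h b]. simpl.
    replace (2 * a + 2 * b - (a + h + b))%Z with (a - h + b)%Z by ring.
    exact H.
  - intros (H1 & H2 & H3).
    destruct (Z.lt_trichotomy 0 (coef_xx Q)) as [Ha|[Ha|Ha]].
    + apply reduced_galois; [|exact Q_nonzero].
      destruct Q as [a h b]. simpl in *. nia.
    + rewrite <- Ha in H1. lia.
    + apply galois_neg_form, reduced_galois; [|now apply neg_form_nonzero].
      destruct Q as [a h b]. simpl in *. nia.
Qed.
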